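(* For all integers $k \ge 1$ and $n \ge 2\left\lceil\frac{k}{2}\right\rceil+2$, $$\mathrm{sat}^*(n,K_{1,k}\cup K_2)\le \binom{2\left\lceil\frac{k}{2}\right\rceil+2}{2}.$$
   Context: All graphs are finite and simple; $K_{1,k}$ is the star with $k$ edges and $\cup$ denotes vertex-disjoint union. An edge-colouring of a graph is proper if incident edges receive different colours, and a subgraph is rainbow if all of its edges receive pairwise distinct colours. A graph $G$ is properly rainbow $H$-saturated if (1) there is a proper edge-colouring of $G$ (with any set of colours) containing no rainbow copy of $H$, and (2) for every edge $e$ of the complement $\overline{G}$, every proper edge-colouring of $G+e$ contains a rainbow copy of $H$. The proper rainbow saturation number $\mathrm{sat}^*(n,H)$ is the minimum number of edges in an $n$-vertex properly rainbow $H$-saturated graph. *)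

(* Defs.v *)
From mathcomp Require Import all_boot.
From mathcomp Require Import boolp.

Set Implicit Arguments.
Unset Strict Implicit.
Unset Printing Implicit Defensive.

Record sgraph (V : finType) := SGraph {
  adj :> rel V;
  adj_sym : symmetric adj;
  adj_irr : irreflexive adj
}.

Definition edges (V : finType) (G : sgraph V) : {set {set V}} :=
  [set e : {set V} | [exists x, exists y, adj G x y && (e == [set x; y])]].

Definition num_edges (V : finType) (G : sgraph V) : nat := #|edges G|.

Lemma star_sym (k : nat) :
  symmetric (fun x y : 'I_k.+1 => (x == ord0) (+) (y == ord0)).
Proof. by move=> x y; rewrite addbC. Qed.

Lemma star_irr (k : nat) :
  irreflexive (fun x y : 'I_k.+1 => (x == ord0) (+) (y == ord0)).
Proof. by move=> x; rewrite addbb. Qed.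

(* K_{1,k}: the centre is ord0, and x, y are adjacent iff exactly one of them
   is the centre. *)
Definition star (k : nat) : sgraph 'I_k.+1 := SGraph (@star_sym k) (@star_irr k).

Lemma complete_sym (n : nat) : symmetric (fun x y : 'I_n => x != y).
Proof. by move=> x y; rewrite eq_sym. Qed.

Lemma complete_irr (n : nat) : irreflexive (fun x y : 'I_n => x != y).
Proof. by move=> x; rewrite eqxx. Qed.

Definition complete (n : nat) : sgraph 'I_n :=
  SGraph (@complete_sym n) (@complete_irr n).

Definition dunion_adj (V W : finType) (G : sgraph V) (H : sgraph W) :
    rel (V + W) :=
  fun a b => match a, b with
             | inl x, inl y => adj G x y
             | inr x, inr y => adj H x y
             | _, _ => false
             end.

Lemma dunion_sym (V W : finType) (G : sgraph V) (H : sgraph W) :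
  symmetric (dunion_adj G H).
Proof. by move=> [x|x] [y|y] //=; apply: adj_sym. Qed.

Lemma dunion_irr (V W : finType) (G : sgraph V) (H : sgraph W) :
  irreflexive (dunion_adj G H).
Proof. by move=> [x|x] /=; apply: adj_irr. Qed.

Definition dunion (V W : finType) (G : sgraph V) (H : sgraph W) :
    sgraph (V + W)%type :=
  SGraph (dunion_sym G H) (dunion_irr G H).

Definition add_edge_adj (V : finType) (G : sgraph V) (x y : V) : rel V :=
  fun u v => adj G u v || ((u != v) && ([set u; v] == [set x; y])).

Lemma add_edge_sym (V : finType) (G : sgraph V) (x y : V) :
  symmetric (add_edge_adj G x y).
Proof.
by move=> u v; rewrite /add_edge_adj adj_sym eq_sym (setUC [set u]).
Qed.

Lemma add_edge_irr (V : finType) (G : sgraph V) (x y : V) :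
  irreflexive (add_edge_adj G x y).
Proof. by move=> u; rewrite /add_edge_adj adj_irr eqxx. Qed.

Definition add_edge (V : finType) (G : sgraph V) (x y : V) : sgraph V :=
  SGraph (add_edge_sym G x y) (add_edge_irr G x y).

(* A colouring is defined on all vertex sets; only its values on edges of the
   graph under consideration matter. *)
Definition proper_colouring (V : finType) (G : sgraph V) (C : Type)
    (c : {set V} -> C) : Prop :=
  forall e f : {set V}, e \in edges G -> f \in edges G ->
    e != f -> e :&: f != set0 -> c e <> c f.

Definition rainbow (V : finType) (C : Type) (c : {set V} -> C)
    (F : {set {set V}}) : Prop :=
  {in F &, injective c}.

Definition has_rainbow_copy (V W : finType) (G : sgraph V) (H : sgraph W)
    (C : Type) (c : {set V} -> C) : Prop :=
  exists phi : W -> V,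
    [/\ injective phi,
        forall x y : W, adj H x y -> adj G (phi x) (phi y)
      & rainbow c [set phi @: e | e : {set W} in edges H]].

Definition rainbow_free_colourable (V W : finType) (G : sgraph V)
    (H : sgraph W) : Prop :=
  exists (C : Type) (c : {set V} -> C),
    proper_colouring G c /\ ~ has_rainbow_copy G H c.

Definition rainbow_saturated (V W : finType) (G : sgraph V) (H : sgraph W) :
    Prop :=
  rainbow_free_colourable G H /\
  forall x y : V, x != y -> ~~ adj G x y ->
    forall (C : Type) (c : {set V} -> C),
      proper_colouring (add_edge G x y) c ->
      has_rainbow_copy (add_edge G x y) H c.

Definition saturated_size (n : nat) (W : finType) (H : sgraph W) (m : nat) :
    Prop :=
  exists G : sgraph 'I_n, rainbow_saturated G H /\ num_edges G = m.

(* The value 0 is only taken when no saturated graph exists, which by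
   sat_starP requires H to be edgeless. *)
Definition sat_star (n : nat) (W : finType) (H : sgraph W) : nat :=
  match pselect (exists m, `[< saturated_size n H m >]) with
  | left ex => ex_minn ex
  | right _ => 0
  end.

Lemma edgesP (V : finType) (G : sgraph V) (x y : V) :
  ([set x; y] \in edges G) = adj G x y.
Proof.
rewrite inE; apply/idP/idP => [|Gxy]; last first.
  by apply/existsP; exists x; apply/existsP; exists y; rewrite Gxy eqxx.
case/existsP=> u /existsP[v /andP[Guv /eqP exy]].
have /set2P xuv : x \in [set u; v] by rewrite -exy set21.
have /set2P yuv : y \in [set u; v] by rewrite -exy set22.
have /set2P uxy : u \in [set x; y] by rewrite exy set21.
have /set2P vxy : v \in [set x; y] by rewrite exy set22.
have nuv : u <> v by move=> euv; move: Guv; rewrite euv adj_irr.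
case: xuv => ex; case: yuv => ey; rewrite ?ex ?ey //.
- by case: vxy; congruence.
- by rewrite adj_sym.
- by case: uxy; congruence.
Qed.

Lemma num_edges_add (V : finType) (G : sgraph V) (x y : V) :
  x != y -> ~~ adj G x y -> num_edges G < num_edges (add_edge G x y).
Proof.
move=> nxy nG; apply: proper_card; apply/properP; split.
  apply/subsetP=> e; rewrite !inE => /existsP[u /existsP[v /andP[Guv ee]]].
  apply/existsP; exists u; apply/existsP; exists v.
  by rewrite ee /= /add_edge_adj Guv.
exists [set x; y]; last by rewrite edgesP.
by rewrite edgesP /= /add_edge_adj nxy eqxx orbT.
Qed.

Lemma saturated_exists (n : nat) (W : finType) (H : sgraph W) :
  (exists x y, adj H x y) -> exists m, saturated_size n H m.
Proof.
move=> [a [b Hab]].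
pose P m := `[< exists2 G : sgraph 'I_n,
                  rainbow_free_colourable G H & num_edges G = m >].
have exP : exists m, P m.
  have s0 : symmetric (fun _ _ : 'I_n => false) by [].
  have i0 : irreflexive (fun _ _ : 'I_n => false) by [].
  exists (num_edges (SGraph s0 i0)); apply/asboolP; exists (SGraph s0 i0) => //.
  exists unit, (fun=> tt); split; last by case=> phi [_ /(_ _ _ Hab)].
  by move=> e f; rewrite inE => /existsP[x /existsP[y]].
have ubP m : P m -> m <= #|{: {set 'I_n}}|.
  by move=> /asboolP[G _ <-]; apply: max_card.
have [m /asboolP[G Gfree Gm] mmax] := ex_maxnP exP ubP.
exists m, G; split=> //; split=> // x y nxy nG C c cprop.
case: (pselect (has_rainbow_copy (add_edge G x y) H c)) => // ncopy.
have : num_edges (add_edge G x y) <= m.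
  by apply: mmax; apply/asboolP; exists (add_edge G x y) => //; exists C, c.
by rewrite leqNgt -Gm num_edges_add.
Qed.

Lemma sat_starP (n : nat) (W : finType) (H : sgraph W) :
  (exists x y, adj H x y) ->
  (exists G : sgraph 'I_n,
     rainbow_saturated G H /\ num_edges G = sat_star n H) /\
  (forall G : sgraph 'I_n,
     rainbow_saturated G H -> sat_star n H <= num_edges G).
Proof.
move=> /(@saturated_exists n)[m0 Hm0]; rewrite /sat_star.
case: pselect => [ex|[]]; last by exists m0; apply/asboolP.
case: ex_minnP => m /asboolP Hm mmin; split=> // G Gsat.
by apply: mmin; apply/asboolP; exists G.
Qed.

(* Main.v *)
(** The extremal graph is the clique on N = 2 * uphalf k + 2 vertices together
    with isolated vertices.  As N is even, K_N has a 1-factorization into N - 1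
    colours, so every colour occurs at every vertex.  In a rainbow copy of the
    star plus an edge xy, the colour of xy would occur at the centre v on some
    edge vw with w distinct from x, y and all the leaves; this makes k + 4 > N
    vertices.  Conversely, let uv be a new edge, with v outside the clique, and
    let c be its colour.  If u is in the clique, then colour c is absent at u
    inside the clique, and N - 1 is odd, so some other clique vertex also misses
    c; it is the centre of a star avoiding u and the colour c.  If u is outside
    the clique, any clique vertex will do as a centre. *)

Require Import Defs.
From mathcomp Require Import all_boot.
From mathcomp Require Import boolp zify.

Set Implicit Arguments.
Unset Strict Implicit.
Unset Printing Implicit Defensive.

(** * Rainbow copies in properly coloured graphs that contain a clique *)

Section Colourings.

Variables (V : finType) (C : Type).
Implicit Types (G : sgraph V) (c : {set V} -> C) (A L : {set V}).

Lemma set2_injr (w x y : V) : w != x -> [set w; x] = [set w; y] -> x = y.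
Proof.
move=> nwx exy; have : x \in [set w; y] by rewrite -exy set22.
by rewrite !inE eq_sym (negbTE nwx) => /eqP.
Qed.

Lemma card_edge G (e : {set V}) : e \in edges G -> #|e| = 2.
Proof.
rewrite inE => /existsP[x /existsP[y /andP[xy /eqP->]]].
by rewrite cards2; case: eqVneq xy => // ->; rewrite adj_irr.
Qed.

Lemma proper_inj G c (w x y : V) : proper_colouring G c ->
  adj G w x -> adj G w y -> c [set w; x] = c [set w; y] -> x = y.
Proof.
move=> cP wx wy ec; have nwx : w != x.
  by apply: contraTneq wx => ->; rewrite adj_irr.
apply: (set2_injr nwx); apply: contrapT => /eqP ne.
case: (cP _ _ _ _ ne _ ec); rewrite ?edgesP //.
by apply/set0Pn; exists w; rewrite !inE eqxx.
Qed.

(** Properness already separates the colours of the star edges at [w], so only a clash between a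
    star edge and [uv] has to be excluded by hypothesis. *)
Lemma star_edge_copy G c (k : nat) (w u v : V) L : proper_colouring G c ->
  adj G u v -> w != u -> w != v -> u \notin L -> v \notin L -> k <= #|L| ->
  (forall l, l \in L -> adj G w l) ->
  (forall l, l \in L -> c [set w; l] <> c [set u; v]) ->
  has_rainbow_copy G (dunion (star k) (complete 2)) c.
Proof.
move=> cP uv wu wv uL vL kL wL cL.
(* Index 0 is the centre, hence the shift by one; the default [w] is never returned at a nonzero
   index, as [L] has at least [k] elements. *)
pose leaf (i : 'I_k.+1) := nth w (enum L) i.-1.
have leafL (i : 'I_k.+1) : i != ord0 -> leaf i \in L.
  move=> i0; rewrite -mem_enum mem_nth // -cardE.
  by case: i i0 => -[|i] //= ik _; apply: leq_trans kL.
have wNL : w \notin L by apply/negP => /wL; rewrite adj_irr.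
have leaf_inj (i j : 'I_k.+1) :
    i != ord0 -> j != ord0 -> leaf i = leaf j -> i = j.
  move=> i0 j0 /eqP; rewrite nth_uniq ?enum_uniq -?cardE //.
  - by case: i j i0 j0 => [[|i] ik] [[|j] jk] //= _ _ /eqP eij; apply: val_inj; congr S.
  - by case: i i0 => -[|i] //= ik _; apply: leq_trans kL.
  - by case: j j0 => -[|j] //= jk _; apply: leq_trans kL.
have nuv : u != v by apply: contraTneq uv => ->; rewrite adj_irr.
pose phi (a : 'I_k.+1 + 'I_2) : V :=
  match a with
  | inl i => if i == ord0 then w else leaf i
  | inr j => if j == ord0 then u else v
  end.
have phi_lr i j : phi (inl i) <> phi (inr j).
  rewrite /phi; case: eqP => [_|/eqP/leafL]; case: ifP => _; try by apply/eqP.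
    by move=> lL e; move: uL; rewrite -e lL.
  by move=> lL e; move: vL; rewrite -e lL.
have ord2 (j : 'I_2) : j != ord0 -> j = ord_max.
  by case: j => -[|[|j]] //= lj _; apply: val_inj.
have phi_edge x y : adj (dunion (star k) (complete 2)) x y ->
    [set phi x; phi y] = [set u; v] \/
    exists2 l, l \in L & [set phi x; phi y] = [set w; l].
  case: x y => [x|x] [y|y] //=.
    case: (eqVneq x ord0) => [_|x0]; case: (eqVneq y ord0) => [_|y0] //= _; right.
      by exists (leaf y); rewrite ?leafL.
    by exists (leaf x); rewrite ?leafL // setUC.
  move=> nxy; left; case: (eqVneq x ord0) nxy => [->|/ord2->].
    by rewrite eq_sym => /negbTE->.
  by case: (eqVneq y ord0) => [_ _|/ord2->]; rewrite ?eqxx // setUC.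
exists phi; split.
- move=> [x|x] [y|y] //.
  + rewrite /phi; case: (eqVneq x ord0) => [->|x0]; case: (eqVneq y ord0) => [->|y0] //.
    * by move=> e; move: wNL; rewrite e leafL.
    * by move=> e; move: wNL; rewrite -e leafL.
    * by move/(leaf_inj _ _ x0 y0) => ->.
  + by move/phi_lr.
  + by move/esym/phi_lr.
  + rewrite /phi; case: (eqVneq x ord0) => [->|/ord2->];
      case: (eqVneq y ord0) => [->|/ord2->] // e; move: nuv; rewrite e eqxx //.
- move=> x y /phi_edge; rewrite -(edgesP G) => -[->|[l lL ->]];
    by rewrite edgesP // wL.
- have FP e : e \in [set phi @: e | e : {set _} in edges (dunion (star k) (complete 2))] ->
      e = [set u; v] \/ exists2 l, l \in L & e = [set w; l].
    case/imsetP=> f; rewrite inE => /existsP[x /existsP[y /andP[xy /eqP->]]] ->.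
    by rewrite imsetU !imset_set1; apply: phi_edge.
  move=> e f /FP[->|[l lL ->]] /FP[->|[m mL ->]] //.
  + by move/esym/(cL _ mL).
  + by move/(cL _ lL).
  + by move/(proper_inj cP (wL _ lL) (wL _ mL)) ->.
Qed.

(** Otherwise the edges inside [A] coloured like [uv] would perfectly match [A :\ u], a set of odd
    size. *)
Lemma clique_missing_vertex G c A (u v : V) : proper_colouring G c ->
  {in A &, forall x y, x != y -> adj G x y} -> ~~ odd #|A| ->
  u \in A -> v \notin A -> adj G u v ->
  exists2 w, w \in A :\ u &
    forall l, l \in A :\ w -> c [set w; l] <> c [set u; v].
Proof.
move=> cP cliqueA evenA uA vA uv.
apply/not_exists2P => noW.
pose P := [set e in edges G | (e \subset A) && `[< c e = c [set u; v] >]].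
have PE e : e \in P =
    [&& e \in edges G, e \subset A & `[< c e = c [set u; v] >]].
  by rewrite in_set.
(* At [u] the colour is taken by [uv], which leaves [A]. *)
have uP e : e \in P -> u \notin e.
  rewrite PE => /and3P[eE eA /asboolP ec]; apply/negP => ue.
  apply: (cP e [set u; v]) ec; rewrite ?edgesP //.
    by apply: contraNneq vA => ee; apply: (subsetP eA); rewrite ee set22.
  by apply/set0Pn; exists u; rewrite !inE ue eqxx.
have P2 e : e \in P -> #|e| = 2.
  by rewrite PE => /andP[/card_edge].
have partP : partition P (A :\ u).
  apply/and3P; split; last by apply/negP => /P2; rewrite cards0.
  - apply/eqP/setP => x; apply/bigcupP/idP => [[e eP xe]|xAu].
      rewrite !inE; apply/andP; split.
        by apply: contraNneq (uP e eP) => <-.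
      by move: eP; rewrite PE => /and3P[_ /subsetP/(_ _ xe)].
    case: (noW x) => // /existsNP[l] /not_implyP[lA /contrapT cl].
    exists [set x; l]; last by rewrite set21.
    move: xAu lA; rewrite PE edgesP !inE => /andP[_ xA] /andP[lx lA].
    by rewrite cliqueA 1?eq_sym // subUset !sub1set xA lA; apply/asboolP.
  - apply/trivIsetP => e f; rewrite !PE.
    move=> /and3P[eE _ /asboolP ec] /and3P[fE _ /asboolP fc] nef.
    rewrite -setI_eq0; apply: contraT => ne.
    by case: (cP e f); rewrite // ec fc.
move: evenA; rewrite (cardsD1 u) uA (card_uniform_partition P2 partP).
by rewrite muln2 /= odd_double.
Qed.

Lemma clique_pendant_copy G c A (k : nat) (u v : V) : proper_colouring G c ->
  {in A &, forall x y, x != y -> adj G x y} -> ~~ odd #|A| -> k.+2 <= #|A| ->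
  v \notin A -> adj G u v ->
  has_rainbow_copy G (dunion (star k) (complete 2)) c.
Proof.
move=> cP cliqueA evenA kA vA uv; have [uA|uA] := boolP (u \in A).
  have [w] := clique_missing_vertex cP cliqueA evenA uA vA uv.
  rewrite !inE => /andP[wu wA] wP.
  apply: (@star_edge_copy _ _ _ w u v (A :\ u :\ w)) => //.
  - by apply: contraNneq vA => <-.
  - by rewrite !inE eqxx andbF.
  - by rewrite !inE (negbTE vA) !andbF.
  - move: kA; rewrite (cardsD1 u) uA (cardsD1 w (A :\ u)) !inE wu wA; lia.
  - by move=> l; rewrite !inE => /and3P[lw lu lA]; rewrite cliqueA // eq_sym.
  - by move=> l; rewrite !inE => /and3P[lw lu lA]; apply: wP; rewrite !inE lw.
have [w wA] : exists w, w \in A by apply/set0Pn; rewrite -card_gt0; lia.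
(* The leaves to avoid: by properness at most one, so at least [k] remain. *)
pose B := [set l in A :\ w | `[< c [set w; l] = c [set u; v] >]].
have B1 : #|B| <= 1.
  apply/card_le1_eqP => x y; rewrite !inE.
  move=> /andP[/andP[xw xA] /asboolP xc] /andP[/andP[yw yA] /asboolP yc].
  by apply: (proper_inj cP (w := w)); rewrite ?cliqueA 1?eq_sym // xc.
apply: (@star_edge_copy _ _ _ w u v (A :\ w :\: B)) => //.
- by apply: contraNneq uA => <-.
- by apply: contraNneq vA => <-.
- by rewrite !inE (negbTE uA) !andbF.
- by rewrite !inE (negbTE vA) !andbF.
- have := cardsID B (A :\ w); have := subset_leq_card (subsetIr (A :\ w) B).
  by move: kA; rewrite (cardsD1 w) wA; lia.
- by move=> l; rewrite !inE => /and3P[_ lw lA]; rewrite cliqueA // eq_sym.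
- move=> l; rewrite !inE => /and3P[nl lw lA] lc; move: nl.
  by rewrite lw lA /= => /asboolP.
Qed.

End Colourings.

(** * The clique with isolated vertices and its saturation *)

Section CliqueGraph.

Variables (V : finType) (A : {set V}).

Definition clique_adj : rel V := fun x y => [&& x != y, x \in A & y \in A].

Lemma clique_sym : symmetric clique_adj.
Proof. by move=> x y; rewrite /clique_adj eq_sym [X in _ && X]andbC. Qed.

Lemma clique_irr : irreflexive clique_adj.
Proof. by move=> x; rewrite /clique_adj eqxx. Qed.

Definition clique : sgraph V := SGraph clique_sym clique_irr.

Lemma num_edges_clique : num_edges clique = 'C(#|A|, 2).
Proof.
rewrite -cards_draws; congr #|pred_of_set _|; apply/setP => e.
rewrite [RHS]inE; apply/idP/andP => [eE|[eA /cards2P[x [y [xy ee]]]]].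
  rewrite (card_edge eE); split=> //; move: eE; rewrite inE.
  case/existsP=> x /existsP[y /andP[/and3P[_ xA yA] /eqP->]].
  by rewrite subUset !sub1set xA yA.
move: eA; rewrite ee edgesP subUset !sub1set => /andP[xA yA].
by rewrite /= /clique_adj xy xA.
Qed.

(* With only #|A| - 1 colours, every colour is used at the centre. *)
Lemma clique_factorization_free (M k : nat) (c : {set V} -> 'I_M) : 0 < k ->
  proper_colouring clique c -> #|A| = M.+1 -> M.+1 <= k + 3 ->
  ~ has_rainbow_copy clique (dunion (star k) (complete 2)) c.
Proof.
move=> k0 cP cA Mk [phi [phiI phiE phiR]].
pose v := phi (inl ord0); pose x := phi (inr ord0); pose y := phi (inr ord_max).
have vl i : i != ord0 -> adj clique v (phi (inl i)).
  by move=> i0; apply: phiE; rewrite /= (negbTE i0).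
have xy : adj clique x y by apply: phiE.
have /and3P[_ vA _] := vl ord_max (lt0n_neq0 k0).
have /and3P[nxy xA yA] := xy.
have vx : v != x by apply/eqP => /phiI.
have vy : v != y by apply/eqP => /phiI.
(* The pattern has no isolated vertex, so its image avoids the isolated vertices of [clique]. *)
have phiA a : phi a \in A.
  case: a => i; first by have [->|/vl/and3P[]] := eqVneq i ord0.
  by case: i => -[|[|i]] // li; [rewrite -[phi _]/(phi (inr _)) (_ : Ordinal li = ord0) //|
     rewrite (_ : Ordinal li = ord_max) //]; apply: val_inj.
have cv_inj : {in A :\ v &, injective (fun w => c [set v; w])}.
  move=> w z; rewrite !inE => /andP[wv wA] /andP[zv zA].
  by apply: (proper_inj cP); rewrite /= /clique_adj eq_sym ?wv ?zv vA.
(* An injection from the [M] neighbours of [v] into [M] colours is onto. *)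
have /imsetP[w] : c [set x; y] \in [set c [set v; w] | w in A :\ v].
  suff -> : [set c [set v; w] | w in A :\ v] = setT by rewrite inE.
  apply/eqP; rewrite eqEcard subsetT cardsT card_ord card_in_imset //.
  by rewrite /= -ltnS -cA (cardsD1 v A) vA.
rewrite !inE => /andP[wv wA] cw.
have vw : adj clique v w by rewrite /= /clique_adj eq_sym wv vA.
(* If [w] were the centre, [vw] would be a loop; if a leaf, [vw] and [xy] would be equally coloured
   edges of the rainbow copy; if [x] or [y], they would be equally coloured incident edges. *)
have wNphi : w \notin codom phi.
  apply/codomP => -[[i|j] wE].
    have i0 : i != ord0 by apply: contraNneq wv => i0; rewrite wE i0.
    have /setP/(_ v) : [set x; y] = [set v; w].
      apply: phiR cw.
        apply/imsetP; exists [set inr ord0; inr ord_max].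
          by rewrite edgesP.
        by rewrite imsetU !imset_set1.
      apply/imsetP; exists [set inl ord0; inl i].
        by rewrite edgesP /= (negbTE i0).
      by rewrite imsetU !imset_set1 wE.
    by rewrite !inE eqxx (negbTE vx) (negbTE vy).
  have {wE j} [wx|wy] : w = x \/ w = y.
  - rewrite wE; case: j {wE} => -[|[|j]] // lj; [left|right];
      by congr (phi (inr _)); apply: val_inj.
  - have : y = v; last by move=> e; move: vy; rewrite e eqxx.
    apply: (proper_inj cP (w := x)) => //; first by rewrite adj_sym -wx.
    by rewrite cw wx setUC.
  - have : x = v; last by move=> e; move: vx; rewrite e eqxx.
    apply: (proper_inj cP (w := y)); first by rewrite adj_sym.
      by rewrite adj_sym -wy.
    by rewrite setUC cw wy setUC.
(* The copy and [w] occupy [k + 4] vertices of [A], which has at most [k + 3]. *)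
have : #|w |: [set z in codom phi]| <= #|A|.
  apply/subset_leq_card/subsetP => z; rewrite !inE => /orP[/eqP->//|].
  by case/codomP=> a ->.
rewrite cardsU1 inE wNphi cardsE card_codom // card_sum !card_ord cA.
by move=> le; have := leq_trans le Mk; rewrite add1n addSn addn2 addn3 ltnn.
Qed.

(** Every non-edge has an endpoint outside [A], which serves as [v] in [clique_pendant_copy]. *)
Lemma clique_saturated (M k : nat) (c : {set V} -> 'I_M) : 0 < k ->
  proper_colouring clique c -> #|A| = M.+1 -> odd M -> k.+2 <= M.+1 <= k + 3 ->
  rainbow_saturated clique (dunion (star k) (complete 2)).
Proof.
move=> k0 cP cA oM /andP[kM Mk]; split.
  by exists 'I_M, c; split=> //; apply: clique_factorization_free.
move=> x y xy nG D d dP.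
have cliqueA : {in A &, forall a b, a != b -> adj (add_edge clique x y) a b}.
  by move=> a b aA bA ab; rewrite /= /add_edge_adj /= /clique_adj ab aA bA.
have Gxy : adj (add_edge clique x y) x y.
  by rewrite /= /add_edge_adj xy eqxx orbT.
have evenA : ~~ odd #|A| by rewrite cA /= oM.
have kA : k.+2 <= #|A| by rewrite cA.
have [yA|yA] := boolP (y \in A); last first.
  exact: (clique_pendant_copy dP cliqueA evenA kA yA Gxy).
have xA : x \notin A by move: nG; rewrite /= /clique_adj xy yA andbT.
by apply: (clique_pendant_copy (u := y) dP cliqueA evenA kA xA); rewrite adj_sym.
Qed.

End CliqueGraph.

(** * The round-robin 1-factorization *)

(* The vertex M plays the role of infinity: the edge ij gets the colour i + j,
   and the edge from i to M gets 2i, modulo the odd number M. *)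
Lemma round_robin_colouring (n M : nat) : odd M -> M < n ->
  exists c : {set 'I_n} -> 'I_M,
    proper_colouring (clique [set i : 'I_n | i < M.+1]) c.
Proof.
move=> oM Mn; have M0 : 0 < M by case: M oM {Mn}.
pose inf := Ordinal Mn.
(* Summing over the set makes the colour independent of the order of the endpoints; with infinity
   present, 2(i + M) reduces to 2i. *)
pose f (e : {set 'I_n}) := (\sum_(i in e) i) * (if inf \in e then 2 else 1).
exists (fun e => Ordinal (ltn_pmod (f e) M0)) => e e' eE e'E ne /set0Pn[w].
rewrite inE => /andP[we we'] /(congr1 val) /= ff.
set G := clique _ in eE e'E.
have edgeP g : g \in edges G -> w \in g ->
    exists2 z, adj G w z & g = [set w; z].
  rewrite inE => /existsP[a /existsP[b /andP[ab /eqP->]]].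
  case/set2P => ->; [by exists b|by exists a; rewrite 1?adj_sym // setUC].
have [x wx eE'] := edgeP e eE we; have [y wy e'E'] := edgeP e' e'E we'.
have xy : x <> y by move=> xy; move: ne; rewrite eE' e'E' xy eqxx.
case: xy; apply: val_inj => /=; move: ff wx wy.
have fE z : adj G w z -> f [set w; z] =
    (w + z) * (if (w == M :> nat) || (z == M :> nat) then 2 else 1).
  case/and3P=> nwz _ _; rewrite /f big_setU1 ?inE //= big_set1.
  by rewrite -!val_eqE /= !(eq_sym M).
rewrite eE' e'E' => + wx wy; rewrite !fE //.
case/and3P: wx wy => + + + /and3P[+ _ +]; rewrite !inE -!val_eqE /=.
move: (val w) (val x) (val y); clear - oM => w x y; rewrite !ltnS.
(* 2 is invertible modulo the odd number [M]; this handles two edges meeting at infinity. *)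
have half a b : a < M -> b < M -> a * 2 = b * 2 %[mod M] -> a = b.
  wlog ba : a b / b <= a.
    by move=> wl aM bM ab; have [/wl->|/ltnW/wl->] := leqP b a.
  move=> aM bM /eqP; rewrite eqn_mod_dvd ?leq_mul2r // -mulnBl.
  rewrite Gauss_dvdl ?coprimen2 // -eqn_mod_dvd // !modn_small //.
  by move/eqP.
have cancel a b : a < M -> b < M -> w + a = w + b %[mod M] -> a = b.
  by move=> aM bM /eqP; rewrite eqn_modDl !modn_small // => /eqP.
have drop_inf a : (a + M) * 2 = a + a %[mod M].
  by rewrite mulnDl [M * 2]mulnC addnC modnMDl muln2 addnn.
move=> nwx; rewrite leq_eqVlt => wM; rewrite leq_eqVlt => xM nwy.
rewrite leq_eqVlt => yM.
case/orP: wM => [/eqP wM|wM].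
  have xlt : x < M by move: xM nwx; rewrite wM eq_sym; case: eqP.
  have ylt : y < M by move: yM nwy; rewrite wM eq_sym; case: eqP.
  rewrite wM eqxx /= ![M + _]addnC !drop_inf !addnn -!muln2.
  exact: half.
rewrite (ltn_eqF wM) /=.
case/orP: xM nwx => [/eqP->|xM]; case/orP: yM nwy => [/eqP->|yM] // nwy nwx.
(* Here [x] is infinity: 2w = w + y modulo [M] would force y = w. *)
- rewrite eqxx (ltn_eqF yM) muln1 drop_inf => /cancel wy.
  by rewrite wy ?eqxx in nwy.
- rewrite eqxx (ltn_eqF xM) muln1 drop_inf => /cancel xw.
  by rewrite xw ?eqxx in nwx.
- rewrite (ltn_eqF xM) (ltn_eqF yM) !muln1; exact: cancel.
Qed.

Theorem theorem4p3 (k n : nat) (hk : 1 <= k) (hn : 2 * uphalf k + 2 <= n) :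
  sat_star n (dunion (star k) (complete 2)) <= 'C(2 * uphalf k + 2, 2).
Proof.
(* [2 * uphalf k] is [k] or [k + 1], so [M] is odd and the clique order [M.+1] is [k + 2] or
   [k + 3]. *)
pose M := (2 * uphalf k).+1.
have oM : odd M by rewrite /= mul2n odd_double.
have Mn : M < n by rewrite /M; lia.
have [c cP] := round_robin_colouring oM Mn.
set A := [set i : 'I_n | i < M.+1] in cP.
have cA : #|A| = M.+1 by rewrite -sum1dep_card big_ord_narrow // sum1_card card_ord.
have kM : k.+2 <= M.+1 <= k + 3 by rewrite /M; lia.
have Hedge : exists x y, adj (dunion (star k) (complete 2)) x y.
  by exists (inr ord0), (inr ord_max).
have [_ /(_ _ (clique_saturated hk cP cA oM kM))] := sat_starP n Hedge.
by rewrite num_edges_clique cA /M addn2.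
Qed.
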